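(* Suppose that $F,G\in\mathcal{P}$, that $\mu$ is a Borel measure on $(0,1)$, and that $\mathbb{E}_F\,\mathrm{GDS}_{\mathrm d}(x,Y;G,\mu)$ is finite for every $x\in I$. If $\chi$ is a crossing point for $F$ on $I$ with respect to $G$, then the mapping $x\mapsto\mathbb{E}_F\,\mathrm{GDS}_{\mathrm d}(x,Y;G,\mu)$, $I\to[0,\infty)$, attains a global minimum at $\chi$.
   Context: Let $I\subseteq\mathbb{R}$ be an interval. $\mathcal{P}$ is the class of Borel probability measures on $\mathbb{R}$ with mass concentrated in $I$; each $F\in\mathcal{P}$ is identified with its right-continuous CDF. $\mathbb{E}_F h(Y)$ denotes the expectation of $h(Y)$ when $Y$ has distribution $F$. The measure $\mu$ is not necessarily a probability measure. $\mathbf{1}$ denotes the indicator function. For $G\in\mathcal{P}$ and $\alpha\in(0,1)$, $G^{-1}(\alpha)=\min\{z\in\mathbb{R}:G(z)\ge\alpha\}$, and $\mathcal{R}(G)=\{\alpha\in(0,1): G(z)=\alpha \text{ for some } z\in\mathbb{R}\}$. The generalized diagonal score for single-valued forecasts is, for $x,y\in I$, $$\mathrm{GDS}_{\mathrm d}(x,y;G,\mu)=\int_{\mathcal{R}(G)}(\mathbf{1}\{y<x\}-\alpha)(\mathbf{1}\{G^{-1}(\alpha)<x\}-\mathbf{1}\{G^{-1}(\alpha)<y\})\,\mathrm{d}\mu(\alpha)\in[0,\infty].$$ Crossing point: for $F,G\in\mathcal{P}$ and an interval $I_0$, a point $\chi\in I_0$ is a crossing point for $F$ on $I_0$ with respect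 to $G$ if $F(z)\le G(z)$ whenever $z\in(-\infty,\chi)\cap I_0$ and $F(z)\ge G(z)$ whenever $z\in[\chi,\infty)\cap I_0$. *)

(* Defs.v *)
From HB Require Import structures.
From mathcomp Require Import all_boot all_order all_algebra.
From mathcomp Require Import all_classical all_reals all_analysis.

Set Implicit Arguments.
Unset Strict Implicit.
Unset Printing Implicit Defensive.

Import Order.TTheory GRing.Theory Num.Theory.
Import numFieldNormedType.Exports.

Local Open Scope classical_set_scope.
Local Open Scope ring_scope.

Definition idTR (R : realType) : measurableTypeR R -> R := idfun.

HB.instance Definition _ (R : realType) :=
  @isMeasurableFun.Build _ _ _ _ (@idTR R) (@measurable_id _ _ setT).

Definition CDF (R : realType) (F : probability (measurableTypeR R) R) (z : R) : R :=
  fine (cdf (@idTR R : {RV F >-> R}) z).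

Definition concentrated_on (R : realType) (I : set R)
    (F : probability (measurableTypeR R) R) : Prop :=
  F I = 1%E.

(* For 0 < alpha < 1 the infimum is a minimum: see [quantile_min] below. *)
Definition quantile (R : realType) (G : probability (measurableTypeR R) R)
    (alpha : R) : R :=
  inf [set z | alpha <= CDF G z].

Definition cdf_range (R : realType) (G : probability (measurableTypeR R) R) : set R :=
  [set alpha | 0 < alpha < 1 /\ exists z, CDF G z = alpha].

(* [b%:R], the boolean b being coerced to nat, is the indicator of b. *)
Definition GDSd (R : realType) (G : probability (measurableTypeR R) R)
    (mu : {measure set (measurableTypeR R) -> \bar R}) (x y : R) : \bar R :=
  (\int[mu]_(alpha in cdf_range G)
     (((y < x)%R%:R - alpha) *
      ((quantile G alpha < x)%R%:R - (quantile G alpha < y)%R%:R))%:E)%E.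

(* The library's ['E_P[X]] is limited to real-valued X, whereas the score is
   [0, +oo]-valued.  Since GDSd is meaningful on I only and F is concentrated
   on I, the integral runs over I. *)
Definition expected_GDSd (R : realType) (I : set R)
    (F G : probability (measurableTypeR R) R)
    (mu : {measure set (measurableTypeR R) -> \bar R}) (x : R) : \bar R :=
  (\int[F]_(y in I) GDSd G mu x y)%E.

Definition crossing_point (R : realType) (I0 : set R)
    (F G : probability (measurableTypeR R) R) (chi : R) : Prop :=
  [/\ I0 chi,
      forall z, I0 z -> z < chi -> CDF F z <= CDF G z &
      forall z, I0 z -> chi <= z -> CDF G z <= CDF F z].

Definition global_min_at (R : realType) (I : set R) (f : R -> \bar R) (chi : R) : Prop :=
  I chi /\ forall x, I x -> (f chi <= f x)%E.

Section sanity.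
Context {R : realType}.
Implicit Types (F G : probability (measurableTypeR R) R) (z alpha : R).

Lemma CDFE F z : CDF F z = fine (F `]-oo, z]%classic).
Proof. by rewrite /CDF /cdf /distribution /pushforward preimage_id. Qed.

Lemma CDF_nondecreasing F : {homo CDF F : x y / x <= y}.
Proof.
by move=> x y xy; rewrite /CDF fine_le ?fin_num_measure// cdf_nondecreasing.
Qed.

Lemma CDF_right_continuous F : right_continuous (CDF F).
Proof.
move=> a; apply: fine_cvg.
by rewrite fineK ?fin_num_measure//; exact: cdf_right_continuous.
Qed.

Lemma CDF_cvgNy F : CDF F @ -oo --> (0 : R).
Proof. exact/fine_cvg/cvg_cdfNy0. Qed.

Lemma CDF_cvgy F : CDF F @ +oo --> (1 : R).
Proof. exact/fine_cvg/cvg_cdfy1. Qed.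

Lemma quantile_min G alpha : 0 < alpha < 1 ->
  alpha <= CDF G (quantile G alpha) /\
  forall z, alpha <= CDF G z -> quantile G alpha <= z.
Proof.
move=> /andP[a0 a1]; set A := [set z | alpha <= CDF G z].
have A0 : A !=set0.
  have /(_ _ _ a1) [M [_ /(_ (M + 1))]] := cvgr_gt _ (@CDF_cvgy G).
  by rewrite ltrDl ltr01 => /(_ erefl)/ltW ?; exists (M + 1).
have lbA : has_lbound A.
  have /(_ _ _ a0) [M [_ /(_ (M - 1))]] := cvgr_lt _ (@CDF_cvgNy G).
  rewrite gtrBl ltr01 => /(_ erefl) Ma; exists (M - 1) => z Az.
  rewrite leNgt; apply/negP => /ltW /(@CDF_nondecreasing G _ _) zM.
  by have := lt_le_trans Ma (le_trans Az zM); rewrite ltxx.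
split; last by move=> z Az; exact: ge_inf.
rewrite leNgt; apply/negP => qa.
have : \forall z \near at_right (quantile G alpha), CDF G z < alpha.
  by apply: cvgr_lt qa; exact: CDF_right_continuous.
case=> e /= e0 He.
have [z Az zq] := inf_adherent e0 (conj A0 lbA).
have qz : inf A <= z by exact: ge_inf.
have [qzE|/negbTE qzN] := eqVneq (inf A) z.
  by move: qa; rewrite /quantile -/A qzE ltNge Az.
have qz' : inf A < z by rewrite lt_neqAle qzN.
have := He z; rewrite /= /quantile -/A distrC ger0_norm ?subr_ge0//.
by rewrite ltrBlDl => /(_ zq qz'); rewrite ltNge Az.
Qed.

Lemma GDSd_ge0 G (mu : {measure set (measurableTypeR R) -> \bar R}) (x y : R) :
  (0 <= GDSd G mu x y)%E.
Proof.
apply: integral_ge0 => a [/andP[/ltW a0 /ltW a1] _]; rewrite lee_fin.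
case: ltP => xy.
  apply: mulr_ge0; first by rewrite subr_ge0.
  rewrite subr_ge0 ler_nat.
  by case: (ltP _ y) => // /lt_trans /(_ xy) ->.
apply: mulr_le0; first by rewrite sub0r oppr_le0.
rewrite subr_le0 ler_nat.
by case: (ltP _ x) => // /lt_le_trans /(_ xy) ->.
Qed.

End sanity.

(* Main.v *)
Require Import Defs.
From HB Require Import structures.
From mathcomp Require Import all_boot all_order all_algebra.
From mathcomp Require Import all_classical all_reals all_analysis.
From mathcomp Require Import measurable_realfun.

Set Implicit Arguments.
Unset Strict Implicit.
Unset Printing Implicit Defensive.

Import Order.TTheory GRing.Theory Num.Theory.
Import numFieldNormedType.Exports.

Local Open Scope classical_set_scope.
Local Open Scope ring_scope.

(** Let q(a) be the a-quantile of G.  For a fixed level a, the integrand of the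
    score at x is (1 - a) 1{y <= q(a)} if q(a) < x and a 1{q(a) < y} if
    x <= q(a) ([scoreE]).  Hence, for x1 <= x2, the scores at x1 and x2 differ
    only through the levels a in A := {a in R(G) | x1 <= q(a) < x2}.  On A the
    F-expectations of the two integrands are a (1 - F(q(a))) at x1 and
    (1 - a) F(q(a)) at x2, so that, after exchanging the two integrals over A,
    the expected scores at x1 and x2 are the integrals of these two functions
    over A plus a common term ([expected_GDSd_split]).

    The difference of the two functions is a - F(q(a)), which is
    G(q(a)) - F(q(a)) because G(q(a)) = a for a in R(G).  Moreover q(a) lies in
    I for such a, as 0 < G(q(a)) < 1 forces G to charge I on both sides of q(a)
    ([quantile_in_support]).  The crossing condition therefore gives the sign of
    the difference on all of A when x1 or x2 is the crossing point, and the
    crossing point has the smaller expected score.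

    The measure mu is arbitrary, so Tonelli's theorem needs sigma-finiteness on
    A.  It follows from finiteness of the two expected scores: for some y the
    scores at x1 and x2 are both finite, and the sum of their integrands is
    positive on A since it equals 1 - a or a there ([sigma_finite_between]).
    As for the common term, it need not be an integral with respect to a
    sigma-finite measure; measurability in y of the inner integral comes from
    quasiconvexity instead ([measurable_integral_score]). *)

(** * Tonelli's theorem on a set where the measure is sigma-finite *)

(** A measure is sigma-finite on a set as soon as some positive function has a
    finite integral there. *)
Lemma sigma_finite_mrestr d (T : measurableType d) (R : realType)
    (mu : {measure set T -> \bar R}) (A : set T) (mA : measurable A)
    (h : T -> R) :
  measurable_fun A h -> (forall x, A x -> 0 < h x) ->
  (\int[mu]_(x in A) (h x)%:E < +oo)%E ->
  sigma_finite setT (mrestr mu mA).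
Proof.
move=> mh h0 hfin.
have mhE : measurable_fun A (fun x => (h x)%:E) by exact/measurable_EFinP.
(* By Markov's inequality each superlevel set of h has finite measure. *)
pose B n := A `&` [set x | ((n.+1%:R^-1)%:E <= (h x)%:E)%E].
have mB n : measurable (B n).
  by apply: emeasurable_fun_c_infty.
exists (fun n => ~` A `|` B n).
  apply/seteqP; split=> // x _.
  have [Ax|nAx] := pselect (A x); last by exists 0%N => //; left.
  have [n] := ltr_add_invr (h0 _ Ax).
  by rewrite add0r => /ltW nh; exists n => //; right; split=> //=; rewrite lee_fin.
move=> n; split; first by apply: measurableU => //; exact: measurableC.
rewrite /mrestr setIUl setICl set0U.
have n0 : (0 < n.+1%:R^-1 :> R) by rewrite invr_gt0.
have := @le_integral_abse _ _ _ mu _ mA (fun x => (h x)%:E) _ mhE n0.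
rewrite (_ : A `&` _ = B n `&` A); last first.
  apply/seteqP; split=> x /= [].
    by move=> Ax; rewrite gtr0_norm ?h0.
  by move=> [Ax nh] _; rewrite /= gtr0_norm ?h0.
under eq_integral => x /[!inE] Ax do rewrite gee0_abs ?lee_fin ?ltW ?h0//.
rewrite -lee_pdivlMl// => /le_lt_trans; apply.
by rewrite lte_mul_pinfty// lee_fin invr_ge0 ltW.
Qed.

Lemma tonelli_in d1 d2 (T1 : measurableType d1) (T2 : measurableType d2)
    (R : realType) (nu : {sigma_finite_measure set T1 -> \bar R})
    (mu : {measure set T2 -> \bar R}) (B : set T1) (A : set T2)
    (mB : measurable B) (mA : measurable A) (f : T1 * T2 -> \bar R) :
  sigma_finite setT (mrestr mu mA) ->
  measurable_fun (B `*` A) f -> (forall p, (B `*` A) p -> (0 <= f p)%E) ->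
  (\int[nu]_(y in B) \int[mu]_(a in A) f (y, a) =
   \int[mu]_(a in A) \int[nu]_(y in B) f (y, a))%E.
Proof.
move=> sfA mf f0.
pose H := Measure_isSigmaFinite.Build _ _ _ (mrestr mu mA) sfA.
pose m : {sigma_finite_measure set T2 -> \bar R} :=
  HB.pack (mrestr mu mA) H.
have muE g : (\int[mu]_(a in A) g a = \int[m]_a (g \_ A) a)%E.
  rewrite -integral_mkcond; apply: eq_measure_integral => C mC CA.
  by rewrite /m/= /mrestr; congr (mu _); apply/esym/setIidl.
transitivity (\int[nu]_y \int[m]_a (f \_ (B `*` A)) (y, a))%E.
  rewrite integral_mkcond; apply: eq_integral => y _; rewrite patchE.
  case: ifPn => [/set_mem By|/negbTE nBy].
    rewrite muE; apply: eq_integral => a _; rewrite !patchE.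
    by rewrite in_setX (mem_set By).
  by rewrite integral0_eq// => a _; rewrite patchE in_setX nBy.
rewrite (fubini_tonelli (m2 := m)); last 2 first.
- by apply/(measurable_restrictT _ _).1 => //; exact: measurableX.
- by move=> p; rewrite patchE; case: ifPn => // /set_mem; exact: f0.
rewrite muE; apply: eq_integral => a _; rewrite patchE.
case: ifPn => [/set_mem Aa|/negbTE nAa].
  rewrite [RHS]integral_mkcond; apply: eq_integral => y _; rewrite !patchE.
  by rewrite in_setX (mem_set Aa) andbT.
by rewrite integral0_eq// => y _; rewrite patchE in_setX nAa andbF.
Qed.

(** * Quantiles and levels in the range of a CDF *)

Section score.
Context {R : realType}.
Implicit Types (F G : probability (measurableTypeR R) R) (x y z a b : R).

Lemma quantile_le G a z : 0 < a < 1 -> (quantile G a <= z) = (a <= CDF G z).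
Proof.
move=> /(quantile_min G) [aq qmin]; apply/idP/idP; last exact: qmin.
by move=> /(@CDF_nondecreasing _ G _ _); exact: le_trans.
Qed.

Lemma quantile_nondecreasing G :
  {in [pred a | 0 < a < 1] &, {homo quantile G : a b / a <= b}}.
Proof.
move=> a b a01 b01 ab; rewrite quantile_le//.
by rewrite (le_trans ab)// -quantile_le.
Qed.

Lemma measurable_quantile G : measurable_fun (`]0, 1[ : set R) (quantile G).
Proof.
apply: (measurability (@RGenCInfty.G R)) => [|/= _ [_] [r] -> <-].
  exact: RGenCInfty.measurableE.
apply: is_interval_measurable => s t /=; rewrite !in_itv/= !andbT.
move=> [s01 rs] [t01 rt] u /andP[su ut].
have u01 : 0 < u < 1.
  case/andP: s01 => s0 _; case/andP: t01 => _ t1.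
  by rewrite (lt_le_trans s0)// (le_lt_trans ut).
by split => //; rewrite in_itv/= andbT (le_trans rs)// quantile_nondecreasing.
Qed.

(** The range condition is tested at the quantile only. *)
Lemma cdf_rangeE G :
  cdf_range G = `]0, 1[ `&` [set a | CDF G (quantile G a) == a].
Proof.
apply/seteqP; split=> a /=; rewrite in_itv/=.
  move=> [a01 [z za]]; split=> //; rewrite eq_le.
  have [-> _] := quantile_min G a01; rewrite andbT -[leRHS]za.
  by apply: CDF_nondecreasing; rewrite quantile_le// za.
by move=> [a01 /eqP qa]; split => //; exists (quantile G a).
Qed.

Lemma measurable_CDF F : measurable_fun setT (CDF F).
Proof. by apply: nondecreasing_measurable => // x y; exact: CDF_nondecreasing. Qed.

Lemma measurable_cdf_range G : measurable (cdf_range G).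
Proof.
rewrite cdf_rangeE.
suff : measurable_fun (`]0, 1[ : set R) (fun a => CDF G (quantile G a) == a).
  by move=> /(_ _ [set true]); rewrite preimage_true; apply.
apply: measurable_fun_eqr => //.
by apply: measurableT_comp; [exact: measurable_CDF|exact: measurable_quantile].
Qed.

(** * The integrand of the score *)

Lemma measurable_natr_bool d (T : measurableType d) (D : set T) (b : T -> bool) :
  measurable_fun D b -> measurable_fun D (fun t => (b t)%:R : R).
Proof. exact: (@measurableT_comp _ _ _ _ _ _ (fun c : bool => c%:R : R)). Qed.

(** The integrand of the generalized diagonal score at forecast x, outcome y and
    level a. *)
Definition score G x y a : R :=
  ((y < x)%R%:R - a) * ((quantile G a < x)%R%:R - (quantile G a < y)%R%:R).

Lemma scoreE G x y a : score G x y a =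
  if quantile G a < x then (1 - a) * (y <= quantile G a)%R%:R
  else a * (quantile G a < y)%R%:R.
Proof.
rewrite /score; case: (ltP (quantile G a) x) => qx;
  case: (ltP (quantile G a) y) => qy;
  rewrite ?subrr ?mulr0 ?subr0 ?mulr1//.
- by rewrite (le_lt_trans qy qx).
- by rewrite ltNge (ltW (le_lt_trans qx qy))/= !sub0r mulrNN mulr1.
Qed.

Lemma score_ge0 G x y a : 0 < a < 1 -> 0 <= score G x y a.
Proof.
move=> /andP[/ltW a0 /ltW a1]; rewrite scoreE.
by case: ifPn => _; rewrite mulr_ge0 ?ler0n// subr_ge0.
Qed.

(** Joint measurability in the outcome and the level. *)
Lemma measurable_score_pair G x :
  measurable_fun ([set: R] `*` (`]0, 1[ : set R))
    (fun p : R * R => score G x p.1 p.2).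
Proof.
have mD : measurable ([set: R] `*` (`]0, 1[ : set R)) by exact: measurableX.
have mq : measurable_fun ([set: R] `*` (`]0, 1[ : set R))
    (fun p : R * R => quantile G p.2).
  apply: (@measurable_comp _ _ _ _ _ _ (`]0, 1[ : set R)) => //.
  - by move=> _ /= [[u v] [_ /= v01] <-].
  - exact: measurable_quantile.
  - by apply: measurable_funTS; exact: measurable_snd.
have m1 : measurable_fun ([set: R] `*` (`]0, 1[ : set R)) (fun p : R * R => p.1).
  by apply: measurable_funTS; exact: measurable_fst.
have m2 : measurable_fun ([set: R] `*` (`]0, 1[ : set R)) (fun p : R * R => p.2).
  by apply: measurable_funTS; exact: measurable_snd.
apply: measurable_funM; apply: measurable_funB => //;
  by apply: measurable_natr_bool; apply: measurable_fun_ltr.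
Qed.

Lemma measurable_score G x y : measurable_fun (`]0, 1[ : set R) (score G x y).
Proof.
apply: measurable_funM; apply: measurable_funB => //;
  apply: measurable_natr_bool; apply: measurable_fun_ltr => //;
  exact: measurable_quantile.
Qed.

(** The integrand is quasiconvex in the outcome, nonincreasing below the forecast
    and nondecreasing above it, uniformly in the level. *)
Lemma score_quasiconvex G x y y1 y2 a : 0 < a < 1 -> y1 <= y <= y2 ->
  score G x y a <= if y < x then score G x y1 a else score G x y2 a.
Proof.
move=> /andP[/ltW a0 /ltW a1] /andP[y1y yy2]; rewrite !scoreE.
case: (ltP (quantile G a) x) => qx; case: (ltP y x) => yx.
- rewrite ler_wpM2l ?subr_ge0// ler_nat.
  have [yq|//] := leP y (quantile G a); first by rewrite (le_trans y1y yq).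
- rewrite [y <= quantile _ _]leNgt (lt_le_trans qx yx) mulr0.
  by rewrite mulr_ge0 ?subr_ge0.
- by rewrite [quantile _ _ < y]ltNge (le_trans (ltW yx) qx) mulr0 mulr_ge0.
- rewrite ler_wpM2l// ler_nat.
  by case: (ltP (quantile G a) y) => // /lt_le_trans /(_ yy2) ->.
Qed.

Section measurable_integral.
Variables (mu : {measure set (measurableTypeR R) -> \bar R}) (A : set R).
Hypotheses (mA : measurable A) (A01 : A `<=` (`]0, 1[ : set R)).

(** Sublevel sets in y are intervals by quasiconvexity; no finiteness assumption
    on the measure is needed. *)
Lemma measurable_integral_score G x : measurable_fun setT
  (fun y => \int[mu]_(a in A) (score G x y a)%:E)%E.
Proof.
set h := (fun y => _).
have mono y y' : (forall a, A a -> score G x y a <= score G x y' a) ->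
    (h y <= h y')%E.
  have ms z : measurable_fun A (fun a => (score G x z a)%:E).
    apply/measurable_EFinP; apply: measurable_funS A01 _ => //.
    exact: measurable_score.
  move=> yy'; apply: ge0_le_integral => //; [|exact: ms|exact: ms].
  by move=> a /A01/= a01; rewrite lee_fin score_ge0.
apply: (measurability (@ErealGenOInfty.G R)) => [|/= _ [_] [r ->] <-].
  exact: ErealGenOInfty.measurableE.
rewrite setTI -[X in measurable X]setCK; apply: measurableC.
apply: is_interval_measurable => y1 y2 /= hy1 hy2 y y12.
move: hy1 hy2; rewrite !in_itv/= !andbT => /negP; rewrite -leNgt => hy1.
move=> /negP; rewrite -leNgt => hy2; apply/negP; rewrite -leNgt.
have [yx|xy] := ltP y x.
- apply: le_trans hy1; apply: mono => a /A01/= a01.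
  by have := score_quasiconvex G x a01 y12; rewrite yx.
- apply: le_trans hy2; apply: mono => a /A01/= a01.
  by have := score_quasiconvex G x a01 y12; rewrite ltNge xy.
Qed.

Lemma integral_score_ge0 G x y : (0 <= \int[mu]_(a in A) (score G x y a)%:E)%E.
Proof.
by apply: integral_ge0 => a /A01/= a01; rewrite lee_fin score_ge0.
Qed.

End measurable_integral.

(** * Levels whose quantile separates two forecasts *)

(** The levels in the range of G whose quantile lies in the interval [x1, x2[:
    those at which the forecasts x1 and x2 are scored differently. *)
Definition cdf_range_between G x1 x2 : set R :=
  cdf_range G `&` [set a | x1 <= quantile G a < x2].

Lemma cdf_range01 G : cdf_range G `<=` (`]0, 1[ : set R).
Proof. by move=> a [a01 _]; rewrite /= in_itv. Qed.

Lemma cdf_range_between01 G x1 x2 :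
  cdf_range_between G x1 x2 `<=` (`]0, 1[ : set R).
Proof. by move=> a [/cdf_range01]. Qed.

Lemma measurable_cdf_range_between G x1 x2 :
  measurable (cdf_range_between G x1 x2).
Proof.
have mr := measurable_cdf_range G.
have mq : measurable_fun (cdf_range G) (quantile G).
  by apply: measurable_funS (@cdf_range01 G) (@measurable_quantile G).
have : measurable_fun (cdf_range G)
    (fun a => (x1 <= quantile G a) && (quantile G a < x2)).
  by apply: measurable_and; [exact: measurable_fun_ler|exact: measurable_fun_ltr].
by move=> /(_ mr [set true]); rewrite preimage_true; apply.
Qed.

Lemma measurable_CDF_quantile F G :
  measurable_fun (`]0, 1[ : set R) (fun a => CDF F (quantile G a)).
Proof.
by apply: measurableT_comp; [exact: measurable_CDF|exact: measurable_quantile].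
Qed.

Lemma CDF_ge0 F z : 0 <= CDF F z.
Proof. by rewrite CDFE fine_ge0. Qed.

Lemma CDF_le1 F z : CDF F z <= 1.
Proof.
rewrite CDFE -lee_fin fineK ?fin_num_measure//.
exact: probability_le1.
Qed.

Lemma quantile_in_support (I : set R) G a : is_interval I ->
  concentrated_on I G -> cdf_range G a -> I (quantile G a).
Proof.
move=> hI hG; have mI := is_interval_measurable hI.
rewrite cdf_rangeE => -[/=]; rewrite in_itv/= => /andP[a0 a1] /eqP qa.
have [u [Iu uq]] : exists u, I u /\ u <= quantile G a.
  apply: contrapT => nu.
  have : (G `]-oo, quantile G a]%classic <= G (~` I))%E.
    apply: le_measure; rewrite ?inE//; first exact: measurableC.
    by move=> u /=; rewrite in_itv/= => uq Iu; apply: nu; exists u.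
  rewrite probability_setC// hG subee// leNgt => /negP; apply.
  by rewrite -[ltRHS]fineK ?fin_num_measure// -CDFE qa lte_fin.
have [v [Iv qv]] : exists v, I v /\ quantile G a <= v.
  apply: contrapT => nv.
  have : (G I <= G `]-oo, quantile G a]%classic)%E.
    apply: le_measure; rewrite ?inE//.
    move=> v Iv /=; rewrite in_itv/= leNgt; apply/negP => /ltW qv.
    by apply: nv; exists v.
  rewrite hG leNgt => /negP; apply.
  by rewrite -[ltLHS]fineK ?fin_num_measure// -CDFE qa lte_fin.
by apply: (hI u v) => //; rewrite uq qv.
Qed.

Lemma integral_concentrated_indic (I : set R) F (B : set R) c :
  measurable I -> concentrated_on I F -> measurable B -> 0 <= c ->
  (\int[F]_(y in I) (c * \1_B y)%:E = c%:E * F B)%E.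
Proof.
move=> mI hF mB c0; under eq_integral do rewrite EFinM.
rewrite ge0_integralZl_EFin//; last exact/measurable_EFinP/measurable_indic.
rewrite integral_indic//; congr (_ * _)%E.
have FI0 : F (B `\` I) = 0%E.
  apply/eqP; rewrite eq_le measure_ge0 andbT.
  rewrite -[leRHS](_ : F (~` I) = 0%E); last by rewrite probability_setC// hF subee.
  apply: le_measure; rewrite ?inE; [exact: measurableD|exact: measurableC|by move=> ? []].
transitivity (F (B `\` I) + F (B `&` I))%E; first by rewrite FI0 add0e.
exact/esym/measureDI.
Qed.

(** * Comparison of the expected scores at two forecasts *)

Section expected.
Variables (I : set R) (F G : probability (measurableTypeR R) R).
Variable mu : {measure set (measurableTypeR R) -> \bar R}.
Hypotheses (mI : measurable I) (hF : concentrated_on I F).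

Lemma expected_score_right x1 x2 a : cdf_range_between G x1 x2 a ->
  (\int[F]_(y in I) (score G x2 y a)%:E =
   ((1 - a) * CDF F (quantile G a))%:E)%E.
Proof.
move=> [[/andP[a0 a1] _]/= /andP[_ qx2]].
under eq_integral do rewrite scoreE qx2.
transitivity (\int[F]_(y in I) ((1 - a) * \1_`]-oo, quantile G a] y)%:E)%E.
  by apply: eq_integral => y _; rewrite indicE mem_setE in_itv.
rewrite integral_concentrated_indic// ?subr_ge0 ?ltW//.
by rewrite EFinM CDFE fineK// fin_num_measure.
Qed.

Lemma expected_score_left x1 x2 a : cdf_range_between G x1 x2 a ->
  (\int[F]_(y in I) (score G x1 y a)%:E =
   (a * (1 - CDF F (quantile G a)))%:E)%E.
Proof.
move=> [[/andP[a0 a1] _]/= /andP[qx1 _]].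
under eq_integral do rewrite scoreE ltNge qx1/=.
transitivity (\int[F]_(y in I) (a * \1_(~` `]-oo, quantile G a]) y)%:E)%E.
  apply: eq_integral => y _; rewrite indicE in_setC mem_setE in_itv/=.
  by rewrite -ltNge.
rewrite integral_concentrated_indic//; [|exact: measurableC|exact: ltW].
by rewrite probability_setC// EFinM EFinB CDFE fineK// fin_num_measure.
Qed.

Lemma exists_finite_GDSd x1 x2 :
  expected_GDSd I F G mu x1 \is a fin_num ->
  expected_GDSd I F G mu x2 \is a fin_num ->
  exists y, (GDSd G mu x1 y + GDSd G mu x2 y < +oo)%E.
Proof.
move=> fin1 fin2; apply: contrapT => nex.
have mG x : measurable_fun I (GDSd G mu x).
  apply: measurable_funTS; apply: measurable_integral_score.
    exact: measurable_cdf_range.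
  exact: cdf_range01.
suff : (expected_GDSd I F G mu x1 + expected_GDSd I F G mu x2 = +oo)%E.
  by move=> sumy; have := fin_numD (expected_GDSd I F G mu x1)
    (expected_GDSd I F G mu x2); rewrite sumy fin1 fin2.
rewrite /expected_GDSd -ge0_integralD//; last 4 first.
- by move=> y _; exact: GDSd_ge0.
- exact: mG.
- by move=> y _; exact: GDSd_ge0.
- exact: mG.
transitivity (\int[F]_(y in I) (+oo : \bar R))%E.
  apply: eq_integral => y _; apply/eqP; rewrite -leye_eq leNgt.
  by apply/negP => fin; apply: nex; exists y.
by rewrite integral_cst// [X in (_ * X)%E](_ : _ = 1%E) ?mule1.
Qed.

Lemma sigma_finite_between x1 x2 :
  expected_GDSd I F G mu x1 \is a fin_num ->
  expected_GDSd I F G mu x2 \is a fin_num ->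
  sigma_finite setT (mrestr mu (measurable_cdf_range_between G x1 x2)).
Proof.
move=> fin1 fin2; have [y fin] := exists_finite_GDSd fin1 fin2.
have mr := measurable_cdf_range G.
have ms x z : measurable_fun (cdf_range G) (fun a => score G x z a).
  by apply: measurable_funS (@cdf_range01 G) (@measurable_score G x z).
apply: (@sigma_finite_mrestr _ (measurableTypeR R) R mu _ _
  (fun a => score G x1 y a + score G x2 y a)).
- by apply: measurable_funS (_ : measurable_fun (cdf_range G) _) => //;
    [move=> a []|exact: measurable_funD].
- move=> a [[/andP[a0 a1] _]/= /andP[qx1 qx2]].
  rewrite !scoreE qx2 [_ < x1]ltNge qx1/= [_ < y]ltNge.
  case: (y <= quantile G a) => /=.
    by rewrite mulr0 add0r mulr1 subr_gt0.
  by rewrite mulr1 mulr0 addr0.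
- apply: le_lt_trans fin; rewrite /GDSd -ge0_integralD//; last 4 first.
  + by move=> a [a01 _]; rewrite lee_fin score_ge0.
  + by apply/measurable_EFinP; exact: ms.
  + by move=> a [a01 _]; rewrite lee_fin score_ge0.
  + by apply/measurable_EFinP; exact: ms.
  apply: ge0_subset_integral => //.
  + exact: measurable_cdf_range_between.
  + by apply/measurable_EFinP; apply: measurable_funD; exact: ms.
  + by move=> a [a01 _]; rewrite lee_fin addr_ge0// score_ge0.
  + by move=> a [].
Qed.

Lemma integral_between_swap x x1 x2 :
  expected_GDSd I F G mu x1 \is a fin_num ->
  expected_GDSd I F G mu x2 \is a fin_num ->
  (\int[F]_(y in I)
     \int[mu]_(a in cdf_range_between G x1 x2) (score G x y a)%:E =
   \int[mu]_(a in cdf_range_between G x1 x2)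
     \int[F]_(y in I) (score G x y a)%:E)%E.
Proof.
move=> fin1 fin2.
apply: (@tonelli_in _ _ (measurableTypeR R) (measurableTypeR R) R F mu I _ mI
  (measurable_cdf_range_between G x1 x2)
  (fun p => (score G x p.1 p.2)%:E)).
- exact: sigma_finite_between.
- apply/measurable_EFinP; apply: measurable_funS (@measurable_score_pair G x).
    exact: measurableX.
  by move=> p [_ /cdf_range_between01].
- by move=> p [_ /cdf_range_between01/= p01]; rewrite lee_fin score_ge0.
Qed.

(** The constant c collects the levels at which x1 and x2 are scored alike; it is
    not claimed to be finite. *)
Lemma expected_GDSd_split x1 x2 : x1 <= x2 ->
  expected_GDSd I F G mu x1 \is a fin_num ->
  expected_GDSd I F G mu x2 \is a fin_num ->
  exists2 c : \bar R,
    expected_GDSd I F G mu x1 = (\int[mu]_(a in cdf_range_between G x1 x2)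
      (a * (1 - CDF F (quantile G a)))%:E + c)%E &
    expected_GDSd I F G mu x2 = (\int[mu]_(a in cdf_range_between G x1 x2)
      ((1 - a) * CDF F (quantile G a))%:E + c)%E.
Proof.
move=> x12 fin1 fin2.
set A := cdf_range_between G x1 x2; set B := cdf_range G `\` A.
have mA : measurable A by exact: measurable_cdf_range_between.
have mB : measurable B by apply: measurableD => //; exact: measurable_cdf_range.
have B01 : B `<=` (`]0, 1[ : set R) by move=> a [/cdf_range01].
have A01 : A `<=` (`]0, 1[ : set R) by exact: cdf_range_between01.
have ABE : cdf_range G = A `|` B.
  by rewrite /B setDE setUIr setUv setIT; apply/esym/setUidr => a [].
have split x : expected_GDSd I F G mu x =
    (\int[mu]_(a in A) \int[F]_(y in I) (score G x y a)%:E +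
     \int[F]_(y in I) \int[mu]_(a in B) (score G x y a)%:E)%E.
  rewrite -integral_between_swap// -ge0_integralD//; last 4 first.
  - by move=> y _; exact: integral_score_ge0.
  - by apply: measurable_funTS; exact: measurable_integral_score.
  - by move=> y _; exact: integral_score_ge0.
  - by apply: measurable_funTS; exact: measurable_integral_score.
  apply: eq_integral => y _; rewrite /GDSd ABE ge0_integral_setU//.
  - apply/measurable_EFinP; rewrite -ABE.
    by apply: measurable_funS (@cdf_range01 G) (@measurable_score G x y).
  - by rewrite -ABE => a [a01 _]; rewrite lee_fin score_ge0.
  - by rewrite disj_set2E /B setDE setICA setICr setI0.
exists (\int[F]_(y in I) \int[mu]_(a in B) (score G x1 y a)%:E)%E.
  rewrite split; congr (_ + _)%E; apply: eq_integral => a /set_mem Aa.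
  exact: expected_score_left Aa.
rewrite split; congr (_ + _)%E.
  by apply: eq_integral => a /set_mem Aa; exact: expected_score_right Aa.
apply: eq_integral => y _; apply: eq_integral => a /set_mem[ra nAa].
rewrite !scoreE; have [q1|q1] := ltP (quantile G a) x1.
  by rewrite (lt_le_trans q1 x12).
have [q2|//] := ltP (quantile G a) x2.
by exfalso; apply: nAa; split => //=; rewrite q1 q2.
Qed.

End expected.

End score.

(* A Borel measure on (0,1) is a Borel measure on R for which the complement of
   (0,1) is null. *)
Theorem corollary4 (R : realType) (I : set R) (hI : is_interval I)
    (F G : probability (measurableTypeR R) R)
    (hF : concentrated_on I F) (hG : concentrated_on I G)
    (mu : {measure set (measurableTypeR R) -> \bar R})
    (hmu : mu (~` `]0, 1[%classic) = 0%E)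
    (hfin : forall x, I x -> expected_GDSd I F G mu x \is a fin_num)
    (chi : R) (hchi : crossing_point I F G chi) :
  global_min_at I (expected_GDSd I F G mu) chi.
Proof.
have [Ichi Fbelow Fabove] := hchi; split=> // x Ix.
have mI := is_interval_measurable hI.
have CDFq a : cdf_range G a -> CDF G (quantile G a) = a.
  by rewrite cdf_rangeE => -[_ /eqP].
have mA x1 x2 := measurable_cdf_range_between G x1 x2.
have ml x1 x2 : measurable_fun (cdf_range_between G x1 x2)
    (fun a => (a * (1 - CDF F (quantile G a)))%:E).
  apply/measurable_EFinP.
  apply: measurable_funS (@cdf_range_between01 _ G x1 x2) _ => //.
  apply: measurable_funM => //; apply: measurable_funB => //.
  exact: measurable_CDF_quantile.
have mr x1 x2 : measurable_fun (cdf_range_between G x1 x2)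
    (fun a => ((1 - a) * CDF F (quantile G a))%:E).
  apply/measurable_EFinP.
  apply: measurable_funS (@cdf_range_between01 _ G x1 x2) _ => //.
  apply: measurable_funM => //; first exact: measurable_funB.
  exact: measurable_CDF_quantile.
have [cx|xc] := leP chi x.
- have [c -> ->] := expected_GDSd_split mI hF cx (hfin _ Ichi) (hfin _ Ix).
  apply: leeD2r; apply: ge0_le_integral => //.
  + exact: mA.
  + move=> a [[/andP[a0 a1] _] _].
    by rewrite lee_fin mulr_ge0 ?subr_ge0 ?CDF_le1// ltW.
  + exact: ml.
  + exact: mr.
  + move=> a [ra /= /andP[cq _]]; rewrite lee_fin.
    have := Fabove _ (quantile_in_support hI hG ra) cq; rewrite CDFq// => ?.
    by rewrite mulrBr mulr1 mulrBl mul1r lerD2r.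
- have [c -> ->] := expected_GDSd_split mI hF (ltW xc) (hfin _ Ix) (hfin _ Ichi).
  apply: leeD2r; apply: ge0_le_integral => //.
  + exact: mA.
  + move=> a [[/andP[a0 a1] _] _].
    by rewrite lee_fin mulr_ge0 ?CDF_ge0// subr_ge0 ltW.
  + exact: mr.
  + exact: ml.
  + move=> a [ra /= /andP[_ qc]]; rewrite lee_fin.
    have := Fbelow _ (quantile_in_support hI hG ra) qc; rewrite CDFq// => ?.
    by rewrite mulrBr mulr1 mulrBl mul1r lerD2r.
Qed.
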